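(* Let $d\in\{2,3\}$, $\mu_0>0$, $\sigma>0$, $\chi\ge 0$, $\mathbf{J}_p\in\mathbb{R}^d$, and let $U:\mathbb{R}^d\to(-\infty,\infty]$ be proper, closed, $\sigma$-strongly convex, and two times continuously differentiable on its domain. Then the co-energy density $$w^*(\mathbf{H})=\frac{\mu_0}{2}|\mathbf{H}|^2-\inf_{\mathbf{J}\in\mathbb{R}^d}\{U(\mathbf{J})-\langle\mathbf{H},\mathbf{J}\rangle+\chi|\mathbf{J}-\mathbf{J}_p|\}$$ is well-defined (finite) and continuously differentiable on $\mathbb{R}^d$, with $$\nabla_{\mathbf{H}}w^*(\mathbf{H})=\mu_0\mathbf{H}+\mathbf{J}(\mathbf{H}),$$ where $\mathbf{J}(\mathbf{H})$ denotes the (unique) minimizer over $\mathbf{J}\in\mathbb{R}^d$ of $U(\mathbf{J})-\langle\mathbf{H},\mathbf{J}\rangle+\chi|\mathbf{J}-\mathbf{J}_p|$. Moreover, for all $\mathbf{H},\tilde{\mathbf{H}}\in\mathbb{R}^d$, $$\langle\nabla_{\mathbf{H}}w^*(\mathbf{H})-\nabla_{\mathbf{H}}w^*(\tilde{\mathbf{H}}),\mathbf{H}-\tilde{\mathbf{H}}\rangle\ge\mu_0|\mathbf{H}-\tilde{\mathbf{H}}|^2,$$ $$|\nabla_{\mathbf{H}}w^*(\mathbf{H})-\nabla_{\mathbf{H}}w^*(\tilde{\mathbf{H}})|\le\frac{1+\sigma\mu_0}{\sigma}|\mathbf{H}-\tilde{\mathbf{H}}|,$$ i.e., $\nabla_{\mathbf{H}}w^*$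 is strongly monotone and Lipschitz continuous.
   Context: $\langle\cdot,\cdot\rangle$ and $|\cdot|$ are the Euclidean inner product and norm on $\mathbb{R}^d$. A function $f:\mathbb{R}^d\to(-\infty,\infty]$ is closed if its epigraph $\{(x,y):y\ge f(x)\}$ is closed; its domain is $\mathrm{dom}(f)=\{x:f(x)<\infty\}$; it is proper if $\mathrm{dom}(f)\neq\emptyset$; it is $\sigma$-strongly convex if $x\mapsto f(x)-\frac{\sigma}{2}|x|^2$ is convex. *)

(* Defs.v *)
From HB Require Import structures.
From mathcomp Require Import all_boot all_order all_algebra.
From mathcomp Require Import all_classical all_reals all_analysis.

Set Implicit Arguments.
Unset Strict Implicit.
Unset Printing Implicit Defensive.
Import Order.TTheory GRing.Theory Num.Theory.
Import numFieldNormedType.Exports.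

Local Open Scope classical_set_scope.
Local Open Scope ring_scope.

(* The library norm `|x| on 'rV[R]_d is the sup norm, so the Euclidean one is
   defined here; both induce the same topology and the same derivatives. *)
Definition dotr (R : realType) (d : nat) (u v : 'rV[R]_d) : R :=
  \sum_(i < d) u 0 i * v 0 i.

Definition enorm (R : realType) (d : nat) (u : 'rV[R]_d) : R :=
  Num.sqrt (dotr u u).

Definition edom (T : Type) (R : realType) (f : T -> \bar R) : set T :=
  [set x | (f x < +oo)%E].

Definition eproper (T : Type) (R : realType) (f : T -> \bar R) : Prop :=
  edom f !=set0.

Definition epigraph (T : Type) (R : realType) (f : T -> \bar R) : set (T * R) :=
  [set xy | (f xy.1 <= xy.2%:E)%E].

Definition eclosed (R : realType) (d : nat) (f : 'rV[R]_d -> \bar R) : Prop :=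
  closed (epigraph f).

(* At t = 0 and t = 1 the inequality is trivial, because 0 * +oo = 0. *)
Definition econvex (R : realType) (d : nat) (f : 'rV[R]_d -> \bar R) : Prop :=
  forall (x y : 'rV[R]_d) (t : R), 0 <= t <= 1 ->
    (f (t *: x + (1 - t) *: y)%R <= t%:E * f x + (1 - t)%:E * f y)%E.

Definition strongly_convex (R : realType) (d : nat) (sigma : R)
    (f : 'rV[R]_d -> \bar R) : Prop :=
  econvex (fun x => (f x - (sigma / 2 * enorm x ^+ 2)%:E)%E).

(* C1_on and C2_on are meant for open sets A. *)
Definition C1_on (R : realType) (V W : normedModType R) (A : set V)
    (f : V -> W) : Prop :=
  forall x, A x ->
    differentiable f x /\ forall v : V, {for x, continuous ('D_v f)}.

Definition C2_on (R : realType) (V W : normedModType R) (A : set V)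
    (f : V -> W) : Prop :=
  C1_on A f /\ forall v : V, C1_on A ('D_v f).

(* The domain need not be open: twice continuously differentiable on it means
   that, near each of its points, f agrees on the domain with a C^2 function
   defined on an open neighbourhood.  For an open domain this is the usual
   notion. *)
Definition C2_on_dom (R : realType) (d : nat) (f : 'rV[R]_d -> \bar R) : Prop :=
  forall x, edom f x ->
    exists (A : set 'rV[R]_d) (g : 'rV[R]_d -> R),
      [/\ open A, A x, C2_on A g &
          forall y, A y -> edom f y -> f y = (g y)%:E].

Definition grad (R : realType) (d : nat) (f : 'rV[R]_d -> R) (x : 'rV[R]_d) :
  'rV[R]_d := \row_(i < d) ('D_(delta_mx 0 i) f x : R).

Definition is_minimizer (T : Type) (R : realType) (f : T -> \bar R) (x : T) :
  Prop := forall y, (f x <= f y)%E.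

Definition objective (R : realType) (d : nat) (U : 'rV[R]_d -> \bar R) (chi : R)
    (Jp H J : 'rV[R]_d) : \bar R :=
  (U J - (dotr H J)%:E + (chi * enorm (J - Jp)%R)%:E)%E.

Definition coenergy (R : realType) (d : nat) (mu0 : R) (U : 'rV[R]_d -> \bar R)
    (chi : R) (Jp H : 'rV[R]_d) : \bar R :=
  ((mu0 / 2 * enorm H ^+ 2)%:E - ereal_inf (range (objective U chi Jp H)))%E.

(* Main.v *)
Require Import Defs.
From HB Require Import structures.
From mathcomp Require Import all_boot all_order all_algebra.
From mathcomp Require Import all_classical all_reals all_analysis.
From mathcomp Require Import ring lra.
Import Order.TTheory GRing.Theory Num.Theory.
Import numFieldNormedType.Exports.
Local Open Scope classical_set_scope.
Local Open Scope ring_scope.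

(* The objective F_H(J) = U(J) - <H,J> + chi |J - Jp| is sigma-strongly convex
   with closed epigraph. It is therefore bounded below, its minimizing sequences
   are Cauchy, and its minimizer J(H) satisfies the quadratic growth
   F_H(J) >= F_H(J(H)) + sigma/2 |J - J(H)|^2. Adding the growth inequalities for
   H and H' yields sigma |J(H) - J(H')|^2 <= <J(H) - J(H'), H - H'>, so J is
   monotone and 1/sigma-Lipschitz. Finally phi(H) = - inf F_H has J(H) as a
   subgradient at H, and applying this at H and at H + h gives
   0 <= phi(H + h) - phi(H) - <J(H), h> <= |h|^2 / sigma, i.e. grad phi = J. *)

Lemma lipschitz_norm_continuous {R : realType} (V W : normedModType R)
    (k : R) (f : V -> W) :
  (forall x y, `|f x - f y| <= k * `|x - y|) -> continuous f.
Proof.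
move=> fk x; apply/cvgrPdist_lt => e e0.
(* The sign of [k] is unrestricted; [|k| + 1] is a positive upper bound by which one may divide. *)
have k0 : 0 < `|k| + 1 by rewrite ltr_wpDl.
near=> y.
apply: (@le_lt_trans _ _ ((`|k| + 1) * `|x - y|)).
  by apply: le_trans (fk x y) _; rewrite ler_wpM2r// ler_wpDr// ler_norm.
rewrite mulrC -ltr_pdivlMr//; near: y.
by apply/nbhs_normP; exists (e / (`|k| + 1)) => //=; rewrite divr_gt0.
Unshelve. all: by end_near. Qed.

(** * Euclidean inner product and norm, and comparison with the sup norm *)

Section Euclidean.
Context {R : realType} {d : nat}.
Implicit Types (u v w : 'rV[R]_d) (a : R).

Lemma dotrC u v : dotr u v = dotr v u.
Proof. by apply: eq_bigr => i _; rewrite mulrC. Qed.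

Lemma dotrDl u v w : dotr (u + v) w = dotr u w + dotr v w.
Proof. by rewrite -big_split; apply: eq_bigr => i _; rewrite mxE mulrDl. Qed.

Lemma dotrZl a u v : dotr (a *: u) v = a * dotr u v.
Proof. by rewrite mulr_sumr; apply: eq_bigr => i _; rewrite mxE mulrA. Qed.

Lemma dotrNl u v : dotr (- u) v = - dotr u v.
Proof. by rewrite -scaleN1r dotrZl mulN1r. Qed.

Lemma dotrDr u v w : dotr u (v + w) = dotr u v + dotr u w.
Proof. by rewrite dotrC dotrDl !(dotrC u). Qed.

Lemma dotrZr a u v : dotr u (a *: v) = a * dotr u v.
Proof. by rewrite dotrC dotrZl dotrC. Qed.

Lemma dotrNr u v : dotr u (- v) = - dotr u v.
Proof. by rewrite dotrC dotrNl dotrC. Qed.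

Definition dotrE := (dotrDl, dotrDr, dotrZl, dotrZr, dotrNl, dotrNr).

Lemma dotr0r u : dotr u 0 = 0.
Proof. by rewrite -(scale0r 0) dotrZr mul0r. Qed.

Lemma dotrr_ge0 u : 0 <= dotr u u.
Proof. by apply: sumr_ge0 => i _; rewrite -expr2 sqr_ge0. Qed.

Lemma dotrr_eq0 u : dotr u u = 0 -> u = 0.
Proof.
move=> /eqP; rewrite psumr_eq0 => [/allP u0|i _]; last by rewrite -expr2 sqr_ge0.
apply/rowP => i; rewrite mxE; apply/eqP.
by have := u0 i (mem_index_enum i); rewrite mulf_eq0 orbb.
Qed.

Lemma enorm_sqr u : enorm u ^+ 2 = dotr u u.
Proof. by rewrite sqr_sqrtr ?dotrr_ge0. Qed.

Lemma enorm_ge0 u : 0 <= enorm u.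
Proof. exact: sqrtr_ge0. Qed.

Lemma enorm0_eq0 u : enorm u = 0 -> u = 0.
Proof. by move=> u0; apply: dotrr_eq0; rewrite -enorm_sqr u0 expr0n. Qed.

Lemma enormZ a u : enorm (a *: u) = `|a| * enorm u.
Proof.
by rewrite /enorm dotrZl dotrZr mulrA -expr2 sqrtrM ?sqr_ge0// sqrtr_sqr.
Qed.

Lemma enormN u : enorm (- u) = enorm u.
Proof. by rewrite -scaleN1r enormZ normrN1 mul1r. Qed.

Lemma enormC u v : enorm (u - v) = enorm (v - u).
Proof. by rewrite -enormN opprB. Qed.

(** Cauchy-Schwarz: for nonzero vectors, expand [0 <= | |v| u - |u| v |^2] and cancel the factor
    [|u| |v|]. *)
Lemma dotr_le_enorm u v : dotr u v <= enorm u * enorm v.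
Proof.
have [->|v0] := eqVneq v 0; first by rewrite dotr0r mulr_ge0 ?enorm_ge0.
have [->|u0] := eqVneq u 0; first by rewrite dotrC dotr0r mulr_ge0 ?enorm_ge0.
have pos w : w != 0 -> 0 < enorm w.
  move=> w0; rewrite lt_neqAle enorm_ge0 andbT eq_sym.
  by apply: contra w0 => /eqP /enorm0_eq0 ->.
have {}u0 := pos _ u0; have {}v0 := pos _ v0.
have := dotrr_ge0 (enorm v *: u - enorm u *: v).
rewrite !dotrE -!enorm_sqr (dotrC v u) => uv.
rewrite -(ler_pM2l (mulr_gt0 u0 v0)).
nra.
Qed.

Lemma normr_dotr_le u v : `|dotr u v| <= enorm u * enorm v.
Proof.
by rewrite ler_norml lerNl -dotrNl -(enormN u) dotr_le_enorm enormN dotr_le_enorm.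
Qed.

Lemma enormD u v : enorm (u + v) <= enorm u + enorm v.
Proof.
rewrite -(@ler_pXn2r _ 2) ?nnegrE ?addr_ge0 ?enorm_ge0// enorm_sqr !dotrE.
rewrite -!enorm_sqr (dotrC v u); have := dotr_le_enorm u v; nra.
Qed.

(** This bound and its converse [enorm_le_normr] carry Euclidean estimates over to the topology of
    the sup norm. *)
Lemma normr_le_enorm u : `|u| <= enorm u.
Proof.
rewrite [leLHS]/Num.Def.normr/= mx_normrE; apply/bigmax_leP.
split=> [|[i j] _ /=]; first exact: enorm_ge0.
rewrite (ord1 i) -sqrtr_sqr ler_sqrt ?dotrr_ge0//.
rewrite /dotr (bigD1 j)//= expr2 lerDl.
by apply: sumr_ge0 => k _; rewrite -expr2 sqr_ge0.
Qed.

Lemma enorm_le_normr u : enorm u <= Num.sqrt d%:R * `|u|.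
Proof.
rewrite -(@ler_pXn2r _ 2) ?nnegrE ?mulr_ge0 ?sqrtr_ge0 ?enorm_ge0//.
rewrite enorm_sqr exprMn sqr_sqrtr ?ler0n// mulr_natl.
have -> : `|u| ^+ 2 *+ d = \sum_(i < d) `|u| ^+ 2 by rewrite sumr_const card_ord.
apply: ler_sum => i _.
rewrite -expr2 -real_normK ?num_real// ler_pXn2r ?nnegrE//.
rewrite [leRHS]/Num.Def.normr/= mx_normrE.
exact: (le_bigmax _ (fun ij : 'I_1 * 'I_d => `|u ij.1 ij.2|) (0, i)).
Qed.

Lemma enorm_lipschitz_continuous (W : normedModType R) (f : 'rV[R]_d -> W) (k : R) :
  (forall x y, `|f x - f y| <= k * enorm (x - y)) -> continuous f.
Proof.
move=> fk; apply: (@lipschitz_norm_continuous _ _ _ (`|k| * Num.sqrt d%:R)).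
move=> x y; apply: le_trans (fk x y) _; rewrite -mulrA.
apply: le_trans (ler_wpM2l (normr_ge0 k) (enorm_le_normr _)).
by rewrite ler_wpM2r ?enorm_ge0// ler_norm.
Qed.

Lemma dotr_continuous u : continuous (dotr u).
Proof.
apply: (@enorm_lipschitz_continuous _ _ (enorm u)) => x y.
by rewrite -dotrNr -dotrDr normr_dotr_le.
Qed.

End Euclidean.

(** * Existence of minimizers and quadratic growth for closed strongly convex functions *)

Section StrongConvexity.
Set Implicit Arguments.
Unset Strict Implicit.
Context {R : realType} {d : nat}.
Implicit Types (D : set 'rV[R]_d) (f : 'rV[R]_d -> R).

(* A function with values in ]-oo, +oo] is encoded by its effective domain D
   and its real values f on D. *)
Definition strongly_convex_on (sigma : R) D f :=
  forall x y t, D x -> D y -> 0 <= t <= 1 ->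
    D (t *: x + (1 - t) *: y) /\
    f (t *: x + (1 - t) *: y) <=
      t * f x + (1 - t) * f y - sigma / 2 * (t * (1 - t)) * enorm (x - y) ^+ 2.

Definition epigraph_on D f : set ('rV[R]_d * R) :=
  [set p | D p.1 /\ f p.1 <= p.2].

Context {sigma : R} {D : set 'rV[R]_d} {f : 'rV[R]_d -> R}.
Hypothesis sigma_gt0 : 0 < sigma.
Hypothesis fconvex : strongly_convex_on sigma D f.

(** Minimality of [x] against [t y + (1 - t) x], divided by [t], gives the claim with an extra
    factor [1 - t]; then [t] tends to 0. *)
Lemma minimum_quadratic_growth x y :
  D x -> (forall z, D z -> f x <= f z) -> D y ->
  f x + sigma / 2 * enorm (y - x) ^+ 2 <= f y.
Proof.
move=> Dx xmin Dy; set S := enorm (y - x) ^+ 2.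
have S0 : 0 <= S by rewrite sqr_ge0.
have key t : 0 < t -> t <= 1 -> sigma / 2 * S * (1 - t) <= f y - f x.
  move=> t0 t1; have /(fconvex Dy Dx)[Dz] : 0 <= t <= 1 by rewrite (ltW t0).
  rewrite -/S => fz; have fxz := xmin _ Dz.
  rewrite -(ler_pM2l t0); nra.
have c0 : 0 <= sigma / 2 * S by rewrite mulr_ge0// divr_ge0// ltW.
rewrite -lerBrDl leNgt; apply/negP.
move: (f y - f x) (sigma / 2 * S) (xmin _ Dy) key c0 => a c _ key c0 ac.
have a0 : 0 <= a by have := key 1 ltr01 (lexx _); rewrite subrr mulr0.
have cpos : 0 < c by apply: le_lt_trans ac.
(* In place of a limit: if [a < c], this [t] makes [c (1 - t)] the midpoint of [a] and [c], which
   exceeds [a]. *)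
have := key ((c - a) / (2 * c)).
rewrite divr_gt0 ?subr_gt0 ?mulr_gt0//.
rewrite ler_pdivrMr ?mulr_gt0// => /(_ isT).
have -> : c * (1 - (c - a) / (2 * c)) = (c + a) / 2 by field; rewrite gt_eqF.
lra.
Qed.

Hypothesis fclosed : closed (epigraph_on D f).

(* Closedness of the epigraph bounds f from below on a ball of radius r around
   x0; strong convexity along the segment from x0 to a point y outside this ball
   then gives f y >= f x0 - s / r + sigma / 2 * (s^2 - r * s), s = |y - x0|. *)
Lemma strongly_convex_bounded_below x0 :
  D x0 -> exists m, forall y, D y -> m <= f y.
Proof.
move=> Dx0.
have [e e0 ballE] : exists2 e, 0 < e & forall y, D y -> enorm (y - x0) < e ->
    f x0 - 1 < f y.
  have : (~` epigraph_on D f) (x0, f x0 - 1).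
    by move=> [_ /=]; rewrite leNgt ltrBlDr ltrDl ltr01.
  move=> nE; have := open_nbhs_nbhs (conj (closed_openC fclosed) nE).
  move=> /nbhs_ballP[e /= e0 eE].
  exists e => // y Dy ye; rewrite ltNge; apply/negP => fy.
  apply: (eE (y, f x0 - 1)); last by [].
  split; last exact: ballxx.
  by rewrite -ball_normE /ball_/= (le_lt_trans (normr_le_enorm _))// enormC.
(* Halving [e] puts the point at distance [r] strictly inside the ball. [b] collects the terms
   linear in [s]: outside the ball [f y > f x0 - b s + sigma/2 s^2], and the right side is at least
   [f x0 - b^2 / (2 sigma)]. *)
pose r := e / 2; pose b := r^-1 + sigma * r / 2.
have r0 : 0 < r by rewrite divr_gt0.
exists (f x0 - 1 - b ^+ 2 / (2 * sigma)) => y Dy.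
have b0 : 0 <= b ^+ 2 / (2 * sigma) by rewrite divr_ge0 ?sqr_ge0// mulr_ge0// ltW.
set s := enorm (y - x0); have [se|es] := ltP s e.
  by have := ballE _ Dy se; lra.
have s0 : 0 < s by apply: lt_le_trans es.
have rs : r <= s by rewrite (le_trans _ es)// /r; lra.
have t01 : 0 <= r / s <= 1 by rewrite ltW ?divr_gt0//= ler_pdivrMr// mul1r.
have [Dz] := fconvex Dy Dx0 t01.
have := ballE _ Dz.
have -> : r / s *: y + (1 - r / s) *: x0 - x0 = (r / s) *: (y - x0).
  by rewrite scalerBl scale1r scalerBr addrA (addrAC _ x0) addrK.
rewrite enormZ ger0_norm; last by case/andP: t01.
rewrite -/s divfK ?gt_eqF// => /(_ _)/wrap[]; first by rewrite /r; lra.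
set z := f (_ + _) => z1 z2.
have {z1 z2} : f x0 - 1 < r / s * f y + (1 - r / s) * f x0 -
    sigma / 2 * (r / s * (1 - r / s)) * s ^+ 2 by apply: lt_le_trans z2.
rewrite -subr_gt0.
have -> : r / s * f y + (1 - r / s) * f x0 - sigma / 2 * (r / s * (1 - r / s)) * s ^+ 2 -
    (f x0 - 1) = (r / s) * (f y - f x0 + b * s - sigma / 2 * s ^+ 2).
  by rewrite /b; field; rewrite !gt_eqF.
rewrite pmulr_rgt0 ?divr_gt0// => fy.
suff : b * s - sigma / 2 * s ^+ 2 <= b ^+ 2 / (2 * sigma) by lra.
rewrite ler_pdivlMr ?mulr_gt0//.
have := sqr_ge0 (b - sigma * s); nra.
Qed.

Lemma strongly_convex_minimizer :
  D !=set0 -> exists2 x, D x & forall y, D y -> f x <= f y.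
Proof.
move=> [x0 Dx0]; have [m0 m0D] := strongly_convex_bounded_below Dx0.
have Dinf : has_inf (f @` D).
  by split; [exists (f x0), x0|exists m0 => _ [y Dy <-]; exact: m0D].
pose m := inf (f @` D).
have mD y : D y -> m <= f y by move=> Dy; apply: (ge_inf Dinf.2); exists y.
have /choice[u uP] : forall n : nat, exists x, D x /\ f x < m + harmonic n.
  move=> n; have [_ [x Dx <-] fx] := inf_adherent (harmonic_gt0 n) Dinf.
  by exists x.
(* At the midpoint, [m <= f z <= (f (u i) + f (u j)) / 2 - sigma/8 |u i - u j|^2], while both values
   exceed [m] by less than the harmonic terms. *)
have udist i j : enorm (u i - u j) ^+ 2 <= 4 / sigma * (harmonic i + harmonic j).
  have [[Di fi] [Dj fj]] := (uP i, uP j).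
  have h01 : 0 <= (2^-1 : R) <= 1 by apply/andP; split; lra.
  have [Dz fz] := fconvex Di Dj h01.
  have := mD _ Dz; rewrite mulrAC ler_pdivlMr//.
  move: fz; set S := enorm _ ^+ 2; set z := f (_ + _).
  move: fi fj; move: (f (u i)) (f (u j)) (harmonic i) (harmonic j).
  move=> a b h k; lra.
have /cauchy_cvg/cvg_ex[/= l ul] : cauchy (u @ \oo).
  apply: cauchy_exP => e e0.
  (* Two harmonic terms below [sigma/8 e^2] make the bound [udist] smaller than [e^2]. *)
  have [N _ hN] : \forall n \near \oo, (harmonic n : R) < sigma / 8 * e ^+ 2.
    have : 0 < sigma / 8 * e ^+ 2 by rewrite mulr_gt0 ?divr_gt0 ?exprn_gt0.
    by move=> he; apply: (cvgr_lt 0) => //; exact: cvg_harmonic.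
  exists (u N); exists N => // n /= Nn.
  rewrite -ball_normE /ball_/= (le_lt_trans (normr_le_enorm _))//.
  rewrite -(@ltr_pXn2r _ 2) ?nnegrE ?enorm_ge0 ?ltW//.
  apply: (le_lt_trans (udist _ _)).
  rewrite mulrAC ltr_pdivrMr//.
  have := hN N (leqnn N); have := hN n Nn; lra.
have mh : m + harmonic n @[n --> \oo] --> m.
  rewrite -[X in _ --> X]addr0.
  by apply: cvgD; [exact: cvg_cst|exact: cvg_harmonic].
(* This yields both [D l] and [f l <= m], so the infimum is attained. *)
have [Dl fl] : epigraph_on D f (l, m).
  apply: (@closed_cvg _ _ \oo _ (fun n => (u n, m + harmonic n)) _ fclosed).
    by near=> n; have [? /ltW] := uP n.
  exact: (cvg_pair ul mh).
by exists l => // y Dy; apply: le_trans fl (mD _ Dy).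
Unshelve. all: by end_near. Qed.

End StrongConvexity.

(** * Stability of strong convexity and closedness under finite perturbations *)

Section Perturbation.
Context {R : realType} {d : nat}.
Implicit Types (D : set 'rV[R]_d) (f g : 'rV[R]_d -> R).

Lemma strongly_convex_onD sigma D f g :
  (forall x y t, 0 <= t <= 1 ->
    g (t *: x + (1 - t) *: y) <= t * g x + (1 - t) * g y) ->
  strongly_convex_on sigma D f -> strongly_convex_on sigma D (f \+ g).
Proof.
move=> gconvex fconvex x y t Dx Dy t01 /=.
have [Dz fz] := fconvex x y t Dx Dy t01; split=> //.
by have := gconvex x y t t01; lra.
Qed.

(** The new epigraph is the preimage of the old one under the continuous shear
    [(x, r) -> (x, r - g x)]. *)
Lemma closed_epigraph_onD D f g :
  continuous g -> closed (epigraph_on D f) -> closed (epigraph_on D (f \+ g)).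
Proof.
move=> gcont fclosed.
have -> : epigraph_on D (f \+ g) =
    (fun p => (p.1, p.2 - g p.1)) @^-1` epigraph_on D f.
  by apply/seteqP; split=> -[x r] [Dx /= fx]; split; move=> //=; lra.
apply: preimage_closed => // -[x r] _.
have c1 : p.1 @[p --> (x, r)] --> x by exact: cvg_fst.
have c2 : p.2 - g p.1 @[p --> (x, r)] --> r - g x.
  by apply: cvgB; [exact: cvg_snd|apply: (cvg_comp _ _ c1); exact: gcont].
exact: (cvg_pair c1 c2).
Qed.

End Perturbation.

(** * The argmin map and the Fenchel conjugate *)

Section Conjugate.
Context {R : realType} {d : nat} {sigma : R} {D : set 'rV[R]_d}.
Context {c : 'rV[R]_d -> R} {J : 'rV[R]_d -> 'rV[R]_d}.
Hypothesis sigma_gt0 : 0 < sigma.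
Hypothesis DJ : forall H, D (J H).
Hypothesis Jmin : forall H y, D y ->
  c (J H) - dotr H (J H) + sigma / 2 * enorm (y - J H) ^+ 2 <= c y - dotr H y.

(** Test the growth at [H] with [J H'] and the growth at [H'] with [J H]: in the sum the values of
    [c] cancel and the two halves of [sigma] add up. *)
Lemma argmin_cocoercive H H' :
  sigma * enorm (J H - J H') ^+ 2 <= dotr (J H - J H') (H - H').
Proof.
have := Jmin H (DJ H'); have := Jmin H' (DJ H).
rewrite (enormC (J H')) (dotrC (J H - J H')) !dotrE; lra.
Qed.

Lemma argmin_lipschitz H H' : enorm (J H - J H') <= sigma^-1 * enorm (H - H').
Proof.
rewrite mulrC ler_pdivlMr// mulrC.
have [->|J0] := eqVneq (enorm (J H - J H')) 0; first by rewrite mulr0 enorm_ge0.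
have {}J0 : 0 < enorm (J H - J H') by rewrite lt_neqAle eq_sym J0 enorm_ge0.
rewrite -(ler_pM2l J0) mulrCA -expr2.
by apply: le_trans (argmin_cocoercive _ _) (dotr_le_enorm _ _).
Qed.

(** The Fenchel conjugate of [c] restricted to [D], since [J H] maximizes [<H, y> - c y] over
    [D]. *)
Let conj H := dotr H (J H) - c (J H).

(** [J H] is a competitor in the supremum that defines the conjugate at [H']. *)
Lemma conj_subgradient H H' : conj H + dotr (J H) (H' - H) <= conj H'.
Proof.
have := Jmin H' (DJ H); rewrite /conj !dotrE !(dotrC (J H)).
have : 0 <= sigma / 2 * enorm (J H - J H') ^+ 2.
  by rewrite mulr_ge0 ?sqr_ge0 ?divr_ge0 ?ltW.
lra.
Qed.

(* The subgradient inequality at H' gives the upper bound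
   dotr (J H' - J H) (H' - H), which is quadratic because J is Lipschitz. *)
Lemma conj_expansion H h :
  0 <= conj (H + h) - conj H - dotr (J H) h <= sigma^-1 * enorm h ^+ 2.
Proof.
have := conj_subgradient H (H + h); have := conj_subgradient (H + h) H.
rewrite opprD addrA subrr add0r (addrC H) addrK dotrNr => h1 h2.
apply/andP; split; first lra.
have := argmin_lipschitz (h + H) H; rewrite addrK => Jl.
have := dotr_le_enorm (J (h + H) - J H) h; rewrite dotrDl dotrNl => Jh.
have := enorm_ge0 h; nra.
Qed.

End Conjugate.

(** * Differentiability and gradients from quadratic remainder bounds *)

Lemma differentiable_quadratic_remainder {R : realType} {V : normedModType R}
    (f : V -> R) (l : {linear V -> R}) (x : V) (k : R) :
  continuous l ->
  (forall h, `|f (h + x) - f x - l h| <= k * `|h| ^+ 2) ->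
  differentiable f x /\ forall v, 'D_v f x = l v.
Proof.
move=> lcont fk.
(* A quadratic remainder is [o(h)], and such an expansion determines the differential. *)
have fE : f \o shift x = cst (f x) + l +o_ 0 id.
  apply/eqaddoP => e e0; near=> h => /=.
  rewrite -[X in `|X|]/(f (h + x) - (f x + l h)) opprD addrA.
  apply: le_trans (fk h) _; rewrite expr2 mulrA ler_wpM2r//.
  apply: (@le_trans _ _ ((`|k| + 1) * `|h|)).
    by rewrite ler_wpM2r// ler_wpDr// ler_norm.
  rewrite mulrC -ler_pdivlMr ?ltr_wpDl//; near: h.
  apply/nbhs_normP; exists (e / (`|k| + 1)) => /=.
    by rewrite divr_gt0 ?ltr_wpDl.
  by move=> h /=; rewrite sub0r normrN => /ltW.
have dE := diff_unique lcont fE.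
have fdiff : differentiable f x by apply/diff_locallyP; rewrite dE.
by split=> // v; rewrite deriveE// dE.
Unshelve. all: by end_near. Qed.

Lemma dotr_is_linear {R : realType} {d : nat} (u : 'rV[R]_d) :
  linear (dotr u : 'rV[R]_d -> R).
Proof. by move=> a v w; rewrite dotrDr dotrZr. Qed.

HB.instance Definition _ (R : realType) (d : nat) (u : 'rV[R]_d) :=
  GRing.isLinear.Build R 'rV[R]_d R *:%R (dotr u) (dotr_is_linear u).

Lemma differentiable_of_gradient {R : realType} {d : nat}
    (f : 'rV[R]_d -> R) (G x : 'rV[R]_d) (k : R) :
  (forall h, `|f (x + h) - f x - dotr G h| <= k * enorm h ^+ 2) ->
  differentiable f x /\ forall v, 'D_v f x = dotr G v.
Proof.
move=> fk; apply: (@differentiable_quadratic_remainder _ _ _ _ _ (`|k| * d%:R)).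
  exact: dotr_continuous.
move=> h; rewrite (addrC h); apply: le_trans (fk h) _.
apply: (@le_trans _ _ (`|k| * enorm h ^+ 2)).
  by rewrite ler_wpM2r ?sqr_ge0// ler_norm.
rewrite -mulrA ler_wpM2l// -[d%:R]sqr_sqrtr ?ler0n// -exprMn.
by rewrite ler_pXn2r ?nnegrE ?mulr_ge0 ?sqrtr_ge0 ?enorm_ge0// enorm_le_normr.
Qed.

Lemma grad_of_derive {R : realType} {d : nat} (f : 'rV[R]_d -> R) (G x : 'rV[R]_d) :
  (forall v, 'D_v f x = dotr G v) -> grad f x = G.
Proof.
move=> fG; apply/rowP => i; rewrite mxE fG /dotr (bigD1 i)//= mxE !eqxx mulr1.
rewrite big1 ?addr0// => j ji.
by rewrite mxE (negbTE ji) andbF mulr0.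
Qed.

(** * From extended-real functions to real functions on their domain *)

Section ExtendedReal.
Context {R : realType} {d : nat} {U : 'rV[R]_d -> \bar R}.
Hypothesis U_gtNy : forall x, (-oo < U x)%E.

Lemma fineK_edom x : edom U x -> U x = (fine (U x))%:E.
Proof. by move=> Ux; rewrite fineK// fin_numE gt_eqF//= lt_eqF. Qed.

Lemma epigraph_on_edom : epigraph_on (edom U) (fine \o U) = epigraph U.
Proof.
apply/seteqP; split=> -[x r] /=; rewrite /epigraph_on/epigraph/=.
  by move=> [Ux]; rewrite -lee_fin -fineK_edom.
move=> Uxr; have Ux : edom U x by apply: le_lt_trans Uxr (ltry _).
by split=> //; rewrite -lee_fin -fineK_edom.
Qed.

(** Finite values at [x] and [y] bound the value at [z], so [z] is in the domain. The identity for
    [|t x + (1 - t) y|^2] then turns convexity of [U - sigma/2 |.|^2] into the inequality with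
    modulus. *)
Lemma strongly_convex_on_edom (sigma : R) :
  strongly_convex sigma U -> strongly_convex_on sigma (edom U) (fine \o U).
Proof.
move=> Uconvex x y t Ux Uy t01; have := Uconvex x y t t01 => /=.
set z := t *: x + _ => Uz.
rewrite (fineK_edom Ux) (fineK_edom Uy) -!EFinD in Uz.
have Dz : edom U z.
  move: Uz; rewrite /edom/=; case: (U z) => //= r; first by rewrite ltry.
split=> //; move: Uz; rewrite (fineK_edom Dz) -EFinD lee_fin /=.
have -> : enorm z ^+ 2 = t * enorm x ^+ 2 + (1 - t) * enorm y ^+ 2
    - t * (1 - t) * enorm (x - y) ^+ 2.
  by rewrite !enorm_sqr /z !dotrE (dotrC y x); ring.
lra.
Qed.

End ExtendedReal.

Lemma enorm_dist_convex {R : realType} {d : nat} (p x y : 'rV[R]_d) {t : R} :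
  0 <= t <= 1 ->
  enorm (t *: x + (1 - t) *: y - p) <= t * enorm (x - p) + (1 - t) * enorm (y - p).
Proof.
move=> /andP[t0 t1].
have -> : t *: x + (1 - t) *: y - p = t *: (x - p) + (1 - t) *: (y - p).
  rewrite !scalerBr addrACA -opprD -scalerDl; congr (_ - _).
  by rewrite addrC subrK scale1r.
apply: le_trans (enormD _ _) _.
by rewrite !enormZ !ger0_norm ?subr_ge0.
Qed.

(** * The minimizer of the objective *)

Section Objective.
Context {R : realType} {d : nat} {sigma chi : R} {Jp : 'rV[R]_d}.
Context {U : 'rV[R]_d -> \bar R}.
Hypothesis sigma_gt0 : 0 < sigma.
Hypothesis chi_ge0 : 0 <= chi.
Hypothesis U_gtNy : forall x, (-oo < U x)%E.
Hypothesis Uproper : eproper U.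
Hypothesis Uclosed : eclosed U.
Hypothesis Uconvex : strongly_convex sigma U.

(** The part of the objective independent of [H], which leaves [H] only in a linear term. It is
    meaningful on [edom U] only, as [fine] sends [+oo] to 0. *)
Let c x : R := fine (U x) + chi * enorm (x - Jp).

Lemma objectiveE H x :
  edom U x -> objective U chi Jp H x = (c x - dotr H x)%:E.
Proof.
by move=> Ux; rewrite /objective (fineK_edom U_gtNy Ux) -EFinB -EFinD addrAC.
Qed.

Lemma objective_pinfty H x : ~ edom U x -> objective U chi Jp H x = +oo%E.
Proof.
rewrite /edom/= /objective; have := U_gtNy x.
by case: (U x) => [r _|//|//] []; rewrite ltry.
Qed.

Lemma objective_argmin : exists J : 'rV[R]_d -> 'rV[R]_d,
  (forall H, edom U (J H)) /\
  (forall H x, edom U x ->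
    c (J H) - dotr H (J H) + sigma / 2 * enorm (x - J H) ^+ 2 <= c x - dotr H x).
Proof.
suff /choice[J JP] : forall H, exists y, edom U y /\ forall x, edom U x ->
    c y - dotr H y + sigma / 2 * enorm (x - y) ^+ 2 <= c x - dotr H x.
  by exists J; split=> H; have [] := JP H.
move=> H.
(* All terms but [U] go into [g], which is finite, convex and continuous, so adding it preserves the
   modulus [sigma] and closedness. *)
pose g (x : 'rV[R]_d) := chi * enorm (x - Jp) - dotr H x.
have cE x : c x - dotr H x = ((fine \o U) \+ g) x by rewrite /c /g /= addrA.
have fconvex : strongly_convex_on sigma (edom U) ((fine \o U) \+ g).
  apply: strongly_convex_onD; last exact: strongly_convex_on_edom.
  move=> x y t t01; rewrite /g !dotrE.
  have := ler_wpM2l chi_ge0 (enorm_dist_convex Jp x y t01); lra.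
have fclosed : closed (epigraph_on (edom U) ((fine \o U) \+ g)).
  apply: closed_epigraph_onD; last by rewrite epigraph_on_edom.
  (* [chi] comes from the reverse triangle inequality, [enorm H] from Cauchy-Schwarz. *)
  apply: (@enorm_lipschitz_continuous _ _ _ _ (chi + enorm H)) => x y.
  have -> : g x - g y = chi * (enorm (x - Jp) - enorm (y - Jp)) - dotr H (x - y).
    by rewrite /g !dotrE; ring.
  apply: le_trans (ler_normB _ _) _; rewrite mulrDl lerD ?normr_dotr_le//.
  rewrite normrM (ger0_norm chi_ge0) ler_wpM2l//.
  have := enormD (x - y) (y - Jp); have := enormD (y - x) (x - Jp).
  rewrite !addrA !subrK (enormC y x) ler_norml => ? ?.
  by apply/andP; split; lra.
have [y Dy ymin] := strongly_convex_minimizer sigma_gt0 fconvex fclosed Uproper.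
exists y; split=> // x Dx; rewrite !cE.
exact: (minimum_quadratic_growth sigma_gt0 fconvex).
Qed.

End Objective.

(** * Regularity of the co-energy density *)

Theorem theorem3 (R : realType) (d : nat) (mu0 sigma chi : R)
    (Jp : 'rV[R]_d) (U : 'rV[R]_d -> \bar R)
    (hd : d = 2%N \/ d = 3%N)
    (hmu0 : 0 < mu0) (hsigma : 0 < sigma) (hchi : 0 <= chi)
    (hUninfty : forall J, (-oo < U J)%E)
    (hUproper : eproper U)
    (hUclosed : eclosed U)
    (hUconvex : strongly_convex sigma U)
    (hUC2 : C2_on_dom U) :
  let w : 'rV[R]_d -> R := fun H => fine (coenergy mu0 U chi Jp H) in
  (forall H : 'rV[R]_d, coenergy mu0 U chi Jp H \is a fin_num) /\
  C1_on setT w /\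
  (exists Jmin : 'rV[R]_d -> 'rV[R]_d,
      (forall H : 'rV[R]_d,
          unique (is_minimizer (objective U chi Jp H)) (Jmin H)) /\
      (forall H : 'rV[R]_d, grad w H = mu0 *: H + Jmin H)) /\
  (forall H H' : 'rV[R]_d,
      mu0 * enorm (H - H') ^+ 2 <= dotr (grad w H - grad w H') (H - H')) /\
  (forall H H' : 'rV[R]_d,
      enorm (grad w H - grad w H') <=
        (1 + sigma * mu0) / sigma * enorm (H - H')).
Proof.
move=> w.
pose c (x : 'rV[R]_d) := fine (U x) + chi * enorm (x - Jp).
have [J [DJ Jgrowth]] : exists J : 'rV[R]_d -> 'rV[R]_d,
    (forall H, edom U (J H)) /\ forall H x, edom U x ->
    c (J H) - dotr H (J H) + sigma / 2 * enorm (x - J H) ^+ 2 <= c x - dotr H x.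
  exact: objective_argmin.
have objE H x : edom U x -> objective U chi Jp H x = (c x - dotr H x)%:E.
  exact: objectiveE.
have Jmin H : is_minimizer (objective U chi Jp H) (J H).
  move=> x; have [Ux|Ux] := pselect (edom U x); last first.
    by rewrite (objective_pinfty hUninfty H Ux) leey.
  rewrite !objE// lee_fin; apply: le_trans (Jgrowth H x Ux).
  by rewrite lerDl mulr_ge0 ?sqr_ge0 ?divr_ge0 ?ltW.
pose conj H := dotr H (J H) - c (J H).
(* The infimum is attained at [J H], so it is the finite number [- conj H]. *)
have coenergyE H :
    coenergy mu0 U chi Jp H = (mu0 / 2 * enorm H ^+ 2 + conj H)%:E.
  rewrite /coenergy; have -> : ereal_inf (range (objective U chi Jp H)) = (- conj H)%:E.
    rewrite /conj opprB -objE//; apply/le_anti/andP; split.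
      by apply: ereal_inf_lbound; exists (J H).
    by apply/ereal_infP => _ [x _ <-]; exact: Jmin.
  by rewrite -EFinB opprK.
have wE H : w H = mu0 / 2 * enorm H ^+ 2 + conj H by rewrite /w coenergyE.
pose G H := mu0 *: H + J H.
have wderiv H : differentiable w H /\ forall v, 'D_v w H = dotr (G H) v.
  (* The quadratic term leaves exactly [mu0/2 |h|^2]; the conjugate leaves between 0 and
     [|h|^2 / sigma]. *)
  apply: (@differentiable_of_gradient _ _ _ _ _ (mu0 / 2 + sigma^-1)) => h.
  have := conj_expansion hsigma DJ Jgrowth H h.
  rewrite -/(conj _) -/(conj _) !wE /G !enorm_sqr !dotrE (dotrC h H).
  have := mulr_ge0 (ltW hmu0) (dotrr_ge0 h).
  move: (conj (H + h)) (conj H) => a b mu0h /andP[h1 h2].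
  by rewrite ger0_norm; lra.
have gradE H : grad w H = G H by apply: grad_of_derive => v; have [_ ->] := wderiv H.
have Jlip := argmin_lipschitz hsigma DJ Jgrowth.
have Glip H H' : enorm (G H - G H') <= (1 + sigma * mu0) / sigma * enorm (H - H').
  have -> : G H - G H' = mu0 *: (H - H') + (J H - J H').
    by rewrite /G opprD addrACA scalerBr.
  apply: le_trans (enormD _ _) _; rewrite enormZ gtr0_norm//.
  have -> : (1 + sigma * mu0) / sigma = mu0 + sigma^-1 by field; rewrite gt_eqF.
  by rewrite mulrDl lerD2l.
split; first by move=> H; rewrite coenergyE.
split.
  move=> H _; split; first by have [] := wderiv H.
  (* Each directional derivative is [<v, G x>], which inherits Lipschitz continuity from [G]. *)
  move=> v; have -> : 'D_v w = (fun x => dotr v (G x)).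
    by apply/funext => x; have [_ ->] := wderiv x; rewrite dotrC.
  apply: (@enorm_lipschitz_continuous _ _ _ _
    (enorm v * ((1 + sigma * mu0) / sigma))) => x y.
  rewrite -dotrNr -dotrDr; apply: le_trans (normr_dotr_le _ _) _.
  by rewrite -mulrA ler_wpM2l ?enorm_ge0.
split.
  exists J; split=> H; last by rewrite gradE.
  split=> // x xmin.
  (* A minimizer outside the domain would have value [+oo], above the finite value at [J H]. *)
  have Ux : edom U x.
    by apply: contrapT => /(objective_pinfty hUninfty H) xoo; move: (xmin (J H));
      rewrite (xoo chi Jp) objE.
  have := xmin (J H); rewrite !objE// lee_fin => xJ.
  have := Jgrowth H x Ux => Jx.
  apply/esym/eqP; rewrite -subr_eq0; apply/eqP/dotrr_eq0/le_anti.
  rewrite dotrr_ge0 andbT -enorm_sqr.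
  (* Quadratic growth leaves no room for a second minimizer at positive distance from [J H]. *)
  have : sigma / 2 * enorm (x - J H) ^+ 2 <= 0 by lra.
  by rewrite pmulr_rle0 ?divr_gt0.
split=> H H'; last by rewrite !gradE.
(* The term [mu0 H] contributes exactly the required bound; the contribution of [J] is nonnegative
   by cocoercivity. *)
rewrite !gradE /G opprD addrACA -scalerBr dotrDl dotrZl -enorm_sqr lerDl.
apply: le_trans (argmin_cocoercive DJ Jgrowth H H').
by rewrite mulr_ge0 ?sqr_ge0 ?ltW.
Qed.
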